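(* For every non-negative integer $n$, \[ \sum_{k=0}^{2n}(-1)^k\binom{2n}{k} C(2n,k)\, C(2n,2n-k)=(-1)^n\cdot C^{(3)}_n\cdot C_n\cdot (2n^2+n+1), \] where $C(N,k)=\frac{N-k+1}{N+1}\binom{N+k}{N}$ for integers $0\le k\le N$, $C_n=\frac{1}{n+1}\binom{2n}{n}$ is the $n$-th Catalan number, and $C^{(3)}_n=\frac{1}{2n+1}\binom{3n}{n}$ is the Fuss--Catalan number of order three.
   Context: $C(N,k)$ (for $0\le k\le N$) are the entries of the Catalan triangle: $C(N,k)$ is the number of lattice paths from $(0,0)$ to $(N,k)$ with steps $(1,0)$ and $(0,1)$ that never rise above the line $y=x$; explicitly $C(N,k)=\frac{N-k+1}{N+1}\binom{N+k}{N}$. *)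

(* Defs.v *)
From mathcomp Require Import all_boot all_order all_algebra.

Set Implicit Arguments.
Unset Strict Implicit.
Unset Printing Implicit Defensive.

Import Order.TTheory GRing.Theory Num.Theory.
Local Open Scope ring_scope.

(* The three families below are rational-valued, so that the divisions in their
   closed forms are exact rather than Euclidean. *)

(* Meaningful for k <= N; N - k is taken in rat, so it is not truncated. *)
Definition catalan_triangle (N k : nat) : rat :=
  (N%:R - k%:R + 1) / (N%:R + 1) * 'C(N + k, N)%:R.

Definition catalan (n : nat) : rat :=
  (n%:R + 1)^-1 * 'C(2 * n, n)%:R.

Definition fuss_catalan3 (n : nat) : rat :=
  (2 * n%:R + 1)^-1 * 'C(3 * n, n)%:R.

(* Main.v *)
(* Put x = k - n. Up to the factor (2n+1)^2 (2n)!^2, the product of the two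
   Catalan-triangle entries is ((n+1)^2 - x^2) P(x), where P(x) is the product
   of i^2 - x^2 for n < i <= 3n, so the sum is a central difference of order 2n.
   Split (n+1)^2 - x^2 = (2n+1) + (n^2 - x^2): the factor n^2 - x^2 is absorbed
   by the binomial coefficient, which lowers the order to 2n-2. Both pieces are
   then central differences of a product of m consecutive i^2 - x^2, for q < i,
   and these have a closed form: writing the last factor as
   (q+m+1)^2 - x^2 = ((q+m+1)^2 - n^2) + (n^2 - x^2) and absorbing n^2 - x^2
   again gives a two-term recurrence in (n, m). *)
Require Import Defs.
From mathcomp Require Import all_boot all_order all_algebra.
From mathcomp Require Import ring zify.

Set Implicit Arguments.
Unset Strict Implicit.
Unset Printing Implicit Defensive.

Import Order.TTheory GRing.Theory Num.Theory.
Local Open Scope ring_scope.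

(* The central difference of order [2 n] of [f] at [0], with unit step. *)
Definition cdiff (R : pzRingType) (n : nat) (f : R -> R) : R :=
  \sum_(0 <= k < (2 * n).+1) (-1) ^+ k * 'C(2 * n, k)%:R * f (k%:R - n%:R).

Definition sqr_diff_prod (R : pzRingType) (q m : nat) (x : R) : R :=
  \prod_(0 <= i < m) ((q + i).+1%:R ^+ 2 - x ^+ 2).

Lemma eq_cdiff (R : pzRingType) n (f g : R -> R) :
  f =1 g -> cdiff n f = cdiff n g.
Proof. by move=> fg; apply: eq_bigr => k _; rewrite fg. Qed.

Lemma cdiffD (R : pzRingType) n (f g : R -> R) :
  cdiff n (fun x => f x + g x) = cdiff n f + cdiff n g.
Proof. by rewrite -big_split; apply: eq_bigr => k _; rewrite mulrDr. Qed.

Lemma cdiffZ (R : comPzRingType) n c (f : R -> R) :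
  cdiff n (fun x => c * f x) = c * cdiff n f.
Proof. by rewrite /cdiff mulr_sumr; apply: eq_bigr => k _; ring. Qed.

Lemma cdiff0n (R : pzRingType) (f : R -> R) : cdiff 0 f = f 0.
Proof. by rewrite /cdiff big_nat1 subrr !mul1r. Qed.

Lemma cdiff1 (R : comPzRingType) n : cdiff n.+1 (fun _ => 1 : R) = 0.
Proof.
have := exprDn (1 : R) (-1) (2 * n.+1).
rewrite subrr expr0n muln_eq0 /= => /esym; apply: etrans; rewrite /cdiff big_mkord.
by apply: eq_bigr => k _; rewrite expr1n mulr1 mul1r mulr_natr.
Qed.

Lemma bin_mul_sub (n k : nat) :
  (k.+1 * (n.+2 - k.+1) * 'C(n.+2, k.+1) = n.+2 * n.+1 * 'C(n, k))%N.
Proof.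
rewrite subSS mulnAC -mul_bin_diag -mulnA [('C(_, _) * _)%N]mulnC.
by rewrite -mul_bin_down mulnA.
Qed.

(** With x = k - (n+1), the factor is k (2n+2-k): it kills both end terms and turns the binomial of
    2n+2 over k into (2n+2)(2n+1) times that of 2n over k-1. Shifting k preserves x and flips the
    sign. *)
Lemma cdiffS_mul (R : comPzRingType) n (f : R -> R) :
  cdiff n.+1 (fun x => (n.+1%:R ^+ 2 - x ^+ 2) * f x)
  = - (2 * n.+1%:R * (2 * n%:R + 1)) * cdiff n f.
Proof.
rewrite /cdiff (_ : 2 * n.+1 = (2 * n).+2)%N ?mulnS//.
rewrite big_nat_recl// big_nat_recr//= mulr_sumr.
rewrite [X in X + _](_ : _ = 0); last by ring.
rewrite [X in _ + (_ + X)](_ : _ = 0); last first.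
  by rewrite -!natr1 natrM; ring.
rewrite add0r addr0 !big_mkord; apply: eq_bigr => k _.
have -> : k.+1%:R - n.+1%:R = k%:R - n%:R :> R by rewrite -!natr1; ring.
have -> : n.+1%:R ^+ 2 - (k%:R - n%:R) ^+ 2 =
          (k.+1 * ((2 * n).+2 - k.+1))%N%:R :> R.
  rewrite natrM natrB; last by have := ltn_ord k; lia.
  by rewrite -!natr1 natrM; ring.
have h : k.+1%:R * ((2 * n).+2 - k.+1)%:R * 'C((2 * n).+2, k.+1)%:R
    = (2 * n%:R + 2) * (2 * n%:R + 1) * 'C(2 * n, k)%:R :> R.
  by rewrite -!natrM bin_mul_sub !natrM -!natr1 natrM; ring.
rewrite exprS.
transitivity (- (-1) ^+ k
    * (k.+1%:R * ((2 * n).+2 - k.+1)%:R * 'C((2 * n).+2, k.+1)%:R)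
    * f (k%:R - n%:R)); first by rewrite natrM; ring.
rewrite h -natr1; ring.
Qed.

Lemma cdiff_sqr_diff_prodS (R : comPzRingType) n q m :
  cdiff n.+1 (sqr_diff_prod q m.+1 : R -> R)
  = ((q + m).+1%:R ^+ 2 - n.+1%:R ^+ 2) * cdiff n.+1 (sqr_diff_prod q m)
    - (2 * n.+1%:R * (2 * n%:R + 1)) * cdiff n (sqr_diff_prod q m).
Proof.
rewrite -mulNr -cdiffS_mul -cdiffZ -cdiffD; apply: eq_cdiff => x.
by rewrite /sqr_diff_prod big_nat_recr//=; ring.
Qed.

(** A difference of order 2n kills polynomials of degree 2m < 2n; the recurrence reduces this to
    constants. *)
Lemma cdiff_sqr_diff_prod_eq0 (R : comPzRingType) n q m :
  (m < n)%N -> cdiff n (sqr_diff_prod q m : R -> R) = 0.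
Proof.
elim: m n => [|m IHm] [|n] // mn.
  by rewrite -[RHS](cdiff1 R n); apply: eq_cdiff => x; rewrite /sqr_diff_prod big_geq.
by rewrite cdiff_sqr_diff_prodS !IHm ?(ltnW mn)//; ring.
Qed.

Lemma factS_natr (R : pzSemiRingType) n : (n.+1)`!%:R = n.+1%:R * n`!%:R :> R.
Proof. by rewrite factS natrM. Qed.

Lemma fact_natr_neq0 (R : numDomainType) n : n`!%:R != 0 :> R.
Proof. by rewrite pnatr_eq0 -lt0n fact_gt0. Qed.

(* A form of Dixon's identity for a well-poised 3F2(1). *)
Lemma cdiff_sqr_diff_prod (R : numFieldType) n q d :
  cdiff n (sqr_diff_prod q (n + d)%N : R -> R)
  = (-1) ^+ n
      * ((2 * n)`!%:R * (q + n + d)`!%:R * (q + d)`!%:R * (n + d)`!%:R)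
      / (n`!%:R * q`!%:R * (q + n)`!%:R * d`!%:R).
Proof.
have f0 := @fact_natr_neq0 R.
have s0 j : j%:R + 1 != 0 :> R by rewrite natr1 pnatr_eq0.
elim: n d => [|n IHn] d.
  (* Order 0 evaluates the product at 0, giving ((q+d)! / q!)^2. *)
  rewrite cdiff0n !add0n addn0.
  elim: d => [|d IHd].
    by rewrite /sqr_diff_prod big_geq// !addn0; field; rewrite !f0.
  rewrite /sqr_diff_prod big_nat_recr//= -/(sqr_diff_prod _ _ _) IHd.
  rewrite !addnS !factS_natr -!natr1; field.
  by rewrite !f0 /= s0.
have s0' : q%:R + n%:R + 1 != 0 :> R by rewrite -natrD s0.
have E2 : (2 * n.+1)`!%:R = 2 * n.+1%:R * (2 * n%:R + 1) * (2 * n)`!%:R :> R.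
  by rewrite mulnS !factS_natr -!natr1 natrM; ring.
elim: d => [|d IHd].
  (* At d = 0 the term of order 2(n+1) has only n factors, so it vanishes. *)
  rewrite addSn cdiff_sqr_diff_prodS cdiff_sqr_diff_prod_eq0 ?addn0// mulr0 add0r.
  rewrite -[X in sqr_diff_prod _ X]addn0 IHn !addn0 E2.
  rewrite !addnS !factS_natr [(-1) ^+ n.+1]exprS -!natr1 !natrD.
  by field; rewrite !f0 s0 s0'.
(* The lower-order term keeps its n+1+d factors, so [IHn] is used at d+1. *)
rewrite addnS cdiff_sqr_diff_prodS IHd addSnnS IHn.
rewrite E2 !(addSn, addnS) !factS_natr [(-1) ^+ n.+1]exprS -!natr1 !natrD.
by field; rewrite !f0 !s0 s0'.
Qed.

Lemma prod_succ_bin (a m : nat) :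
  (\prod_(0 <= i < m) (a + i).+1 = m`! * 'C(a + m, m))%N.
Proof.
elim: m => [|m IHm]; first by rewrite big_geq ?bin0.
by rewrite big_nat_recr//= IHm factS addnS [RHS]mulnAC -mul_bin_diag mulnC mulnAC mulnA.
Qed.

(** Each factor splits as (n+i+1)^2 - (k-n)^2 = (k+i+1)(2n-k+i+1), leaving two products of
    consecutive integers. *)
Lemma sqr_diff_prod_bin (R : comPzRingType) (n k : nat) : (k <= 2 * n)%N ->
  sqr_diff_prod n (2 * n) (k%:R - n%:R) =
  (2 * n)`!%:R ^+ 2 * 'C(2 * n + k, 2 * n)%:R
    * 'C(2 * n + (2 * n - k), 2 * n)%:R :> R.
Proof.
move=> kn; rewrite addnC [(2 * n + (_ - _))%N]addnC.
transitivity ((\prod_(0 <= i < 2 * n) (k + i).+1)%N%:R *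
  (\prod_(0 <= i < 2 * n) ((2 * n - k) + i).+1)%N%:R : R); last first.
  by rewrite !prod_succ_bin !natrM; ring.
rewrite !natr_prod -big_split /=; apply: eq_bigr => i _.
by rewrite -!natr1 !natrD natrB// natrM; ring.
Qed.

Theorem theorem1 (n : nat) :
  \sum_(0 <= k < (2 * n).+1)
     (-1) ^+ k * 'C(2 * n, k)%:R
       * catalan_triangle (2 * n) k * catalan_triangle (2 * n) (2 * n - k)
  = (-1) ^+ n * fuss_catalan3 n * catalan n * (2 * n%:R ^+ 2 + n%:R + 1).
Proof.
have f0 := @fact_natr_neq0 rat.
have s0 j : j%:R + 1 != 0 :> rat by rewrite natr1 pnatr_eq0.
have d0 : 2 * n%:R + 1 != 0 :> rat by rewrite -natrM s0.
pose P : rat -> rat := sqr_diff_prod n (2 * n).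
(* The numerators multiply to (2n-k+1)(k+1) = (n+1)^2 - x^2. *)
transitivity (((2 * n%:R + 1) * (2 * n)`!%:R) ^- 2 *
    ((2 * n%:R + 1) * cdiff n P
     + cdiff n (fun x => (n%:R ^+ 2 - x ^+ 2) * P x))).
  rewrite -cdiffZ -cdiffD /cdiff mulr_sumr; apply: eq_big_nat => k.
  rewrite ltnS => /= kn.
  rewrite /P sqr_diff_prod_bin// /catalan_triangle natrB// natrM.
  by field; rewrite f0 d0.
have -> : cdiff n P = (-1) ^+ n * (2 * n)`!%:R ^+ 2 * (3 * n)`!%:R / n`!%:R ^+ 3.
  rewrite /P (_ : 2 * n = n + n)%N ?mul2n -?addnn// cdiff_sqr_diff_prod.
  by rewrite (_ : 3 * n = n + n + n)%N ?mul2n -?addnn; [field; rewrite !f0|lia].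
have -> : cdiff n (fun x => (n%:R ^+ 2 - x ^+ 2) * P x) =
  (2 * n%:R + 1) * (2 * n%:R ^+ 2 / (n%:R + 1)) *
  ((-1) ^+ n * (2 * n)`!%:R ^+ 2 * (3 * n)`!%:R / n`!%:R ^+ 3).
  (* Absorption needs positive order; at n = 0 both sides are 0. Otherwise the closed form applies
     with d = n+2 for the predecessor n. *)
  case: n @P d0 => [|n] P d0; first by rewrite cdiff0n; ring.
  rewrite cdiffS_mul /P (_ : 2 * n.+1 = n + n.+2)%N; last by lia.
  rewrite cdiff_sqr_diff_prod.
  rewrite (_ : n.+1 + n + n.+2 = 3 * n.+1)%N; last by lia.
  rewrite (_ : n + n.+2 = (2 * n).+2)%N; last by lia.
  rewrite (_ : n.+1 + n.+2 = (2 * n).+3)%N; last by lia.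
  rewrite (_ : n.+1 + n = (2 * n).+1)%N; last by lia.
  rewrite !factS_natr -!natr1 natrM [(-1) ^+ n.+1]exprS.
  by field; rewrite !f0 s0 natr1 s0 -natrM s0.
have -> : fuss_catalan3 n = (2 * n%:R + 1)^-1 * ((3 * n)`!%:R / (n`!%:R * (2 * n)`!%:R)).
  rewrite /fuss_catalan3 -(@bin_fact (3 * n) n); last by lia.
  rewrite (_ : 3 * n - n = 2 * n)%N; last by lia.
  by rewrite !natrM; field; rewrite !f0 d0.
have -> : catalan n = (n%:R + 1)^-1 * ((2 * n)`!%:R / n`!%:R ^+ 2).
  rewrite /catalan -(@bin_fact (2 * n) n); last by lia.
  rewrite (_ : 2 * n - n = n)%N; last by lia.
  by rewrite !natrM; field; rewrite !f0 s0.
(* The last factor arises from 1 + 2n^2/(n+1) = (2n^2+n+1)/(n+1). *)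
by field; rewrite !f0 s0 d0.
Qed.
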